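(* Let $n>d$, $d=d_1+\dots+d_p$ with $d_i\ge1$, $d_{p+1}=n-d$, $\vec d=(d_1,\dots,d_p,d_{p+1})$, and let $\mathrm{Flag}(\vec d)=\mathrm{St}_{n,d}/\mathcal K_{St}$, $\mathcal K_{St}=\mathrm O(d_1)\times\cdots\times\mathrm O(d_p)$, carry the quotient of the metric $\langle\xi,\xi\rangle=\operatorname{Tr}\xi^{\mathsf T}\xi+(\alpha-1)\operatorname{Tr}\xi^{\mathsf T}YY^{\mathsf T}\xi$ on $\mathrm{St}_{n,d}$ for $\alpha=\frac12$. At $Y\in\mathrm{St}_{n,d}$, let $\xi=YA+QR$ be a horizontal vector, where $A=Y^{\mathsf T}\xi$, $Q\in\mathbb R^{n\times k}$ has columns forming an orthonormal basis of the column span of $\xi-YY^{\mathsf T}\xi$ (of dimension $k$), and $R\in\mathbb R^{k\times d}$. Then the parallel transport of a horizontal vector $\eta\in T_Y\mathrm{St}_{n,d}$ of $\mathrm{Flag}(\vec d)$, along the geodesic with initial horizontal velocity $\xi$ at $Y$, lifts to $\mathrm{St}_{n,d}$ as $$\Delta(t)=\begin{bmatrix}Y|Q\end{bmatrix}\operatorname{expm}\!\left(t\begin{bmatrix}A&-R^{\mathsf T}\\R&0\end{bmatrix}\right)\operatorname{expv}\!\left(t\mathrm P,\begin{bmatrix}Y|Q\end{bmatrix}^{\mathsf T}\eta\right)+(\eta-YY^{\mathsf T}\eta-QQ^{\mathsf T}\eta)\operatorname{expm}\!\left(\tfrac t2A\right).$$ With $\mathtt V=\begin{bmatrix}A&-R^{\mathsf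 T}\\R&0\end{bmatrix}$ and $\mathtt W=\begin{bmatrix}\mathtt W_a&-\mathtt W_r^{\mathsf T}\\\mathtt W_r&0\end{bmatrix}$ (identified with its first $d$ columns $\begin{bmatrix}\mathtt W_a\\\mathtt W_r\end{bmatrix}$), $\mathrm P$ is given by $$\mathrm P(\mathtt W)=\mathrm P_{\mathtt V}(\mathtt W):=\begin{bmatrix}\mathcal P_{\mathfrak m}(\mathtt W_aA+R^{\mathsf T}\mathtt W_r)_{\mathrm{skew}}\\\frac12(\mathtt W_rA-R\mathtt W_a)\end{bmatrix}.$$
   Context: $\mathrm{St}_{n,d}=\{Y\in\mathbb R^{n\times d}:Y^{\mathsf T}Y=I_d\}$, with $T_Y\mathrm{St}_{n,d}=\{\xi: Y^{\mathsf T}\xi\text{ antisymmetric}\}$. Partition the columns of $Y$ into blocks of sizes $d_1,\dots,d_p$; $U=\operatorname{diag}(U_1,\dots,U_p)\in\mathcal K_{St}$ acts by $Y\mapsto YU$, by isometries. The ''flag diagonal blocks'' of a $d\times d$ matrix are its $p$ diagonal blocks of sizes $d_1,\dots,d_p$. A tangent vector $\xi$ at $Y$ is horizontal (orthogonal to the $\mathcal K_{St}$-orbit) if $Y^{\mathsf T}\xi$ is antisymmetric with zero flag diagonal blocks. The geodesic and parallel transport are those of the Levi-Civita connection of $\mathrm{Flag}(\vec d)$, represented by their horizontal lifts to $\mathrm{St}_{n,d}$. $\mathcal P_{\mathfrak m}$ sets the flag diagonal blocks of a $d\times d$ matrix to zero; $M_{\mathrm{skew}}=\frac12(M-M^{\mathsf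 T})$; in $\mathrm P(\mathtt W)$, $\mathtt W_a$ is an antisymmetric $d\times d$ matrix with zero flag diagonal blocks and $\mathtt W_r\in\mathbb R^{k\times d}$. If $\xi=YY^{\mathsf T}\xi$, then $k=0$ and the terms with $Q,R$ are absent. $\operatorname{expm}$ is the matrix exponential and $\operatorname{expv}(t\mathrm P,v)=e^{t\mathrm P}v$ for a linear operator $\mathrm P$ on a matrix space. $[Y|Q]$ denotes horizontal concatenation. *)

(* Defs.v *)
From HB Require Import structures.
From mathcomp Require Import all_boot all_order all_algebra.
From mathcomp Require Import all_classical all_reals all_analysis.

Set Implicit Arguments.
Unset Strict Implicit.
Unset Printing Implicit Defensive.

Import Order.TTheory GRing.Theory Num.Theory.
Import numFieldNormedType.Exports.

Local Open Scope classical_set_scope.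
Local Open Scope ring_scope.

Section Calculus.
Variable R : realType.

Fixpoint iter_differentiable (V W : normedModType R) (m : nat) (f : V -> W)
    : Prop :=
  if m is m'.+1 then
    (forall x, differentiable f x) /\
    (forall v, iter_differentiable m' (fun x => 'D_v f x))
  else continuous f.

(* For finite-dimensional V this is the usual notion of a C^infinity map. *)
Definition smooth (V W : normedModType R) (f : V -> W) : Prop :=
  forall m, iter_differentiable m f.

Definition expm (m : nat) (A : 'M[R]_m) : 'M[R]_m :=
  limn (series (fun i => (i`!%:R)^-1 *: A ^+ i)).

(* e^L v, for a linear operator L on a space of matrices. *)
Definition expv (m q : nat) (L : 'M[R]_(m, q) -> 'M[R]_(m, q))
    (v : 'M[R]_(m, q)) : 'M[R]_(m, q) :=
  limn (series (fun i => (i`!%:R)^-1 *: iter i L v)).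

End Calculus.

Section Flag.
Variables (R : realType) (n p : nat) (d_ : 'I_p -> nat).

Local Notation d := (\sum_i d_ i)%N.
Local Notation mat := 'M[R]_(n, d).

Definition stiefel (Y : mat) : Prop := Y^T *m Y = 1%:M.

Definition flag_group (U : 'M[R]_d) : Prop :=
  exists2 B : forall i, 'M[R]_(d_ i),
    (forall i, (B i)^T *m B i = 1%:M) & U = \mxdiag_i B i.

Definition metric (alpha : R) (Y xi eta : mat) : R :=
  \tr (xi^T *m eta) + (alpha - 1) * \tr (xi^T *m Y *m Y^T *m eta).

Definition horizontal (Y xi : mat) : Prop :=
  (Y^T *m xi)^T = - (Y^T *m xi) /\
  forall i, submxblock (Y^T *m xi) i i = 0.

(* Tangent to the orbit Y K, that is, in the kernel of the differential at Y
   of the projection from the Stiefel to the flag manifold. *)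
Definition vertical (Y xi : mat) : Prop :=
  exists2 B : forall i, 'M[R]_(d_ i),
    (forall i, (B i)^T = - B i) & xi = Y *m \mxdiag_i B i.

(* The flag manifold is handled through its lifts to the Stiefel manifold:
   functions on it are invariant functions, and vector fields on it are
   equivariant horizontal vector fields.  The Stiefel manifold being compact,
   its smooth maps are exactly the restrictions of smooth maps of the ambient
   space, so lifts are given as ambient maps, of which only the values at
   Stiefel points are meaningful. *)

Definition flag_function (f : mat -> R) : Prop :=
  smooth f /\
  forall Y U, stiefel Y -> flag_group U -> f (Y *m U) = f Y.

Definition flag_field (X : mat -> mat) : Prop :=
  [/\ smooth X,
      forall Y, stiefel Y -> horizontal Y (X Y) &
      forall Y U, stiefel Y -> flag_group U -> X (Y *m U) = X Y *m U].

Definition lie_bracket (X Z : mat -> mat) (Y : mat) : mat :=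
  'D_(X Y) Z Y - 'D_(Z Y) X Y.

(* The Levi-Civita connection of the flag manifold, with the quotient metric:
   the torsion-free metric affine connection.  The bracket of two fields of
   the flag manifold is lifted by the bracket of the lifts up to a vertical
   field. *)
Record levi_civita (alpha : R)
    (nabla : (mat -> mat) -> (mat -> mat) -> (mat -> mat)) : Prop := {
  connection_field : forall X Z,
    flag_field X -> flag_field Z -> flag_field (nabla X Z);
  connectionDl : forall X1 X2 Z Y,
    flag_field X1 -> flag_field X2 -> flag_field Z -> stiefel Y ->
    nabla (fun Y' => X1 Y' + X2 Y') Z Y = nabla X1 Z Y + nabla X2 Z Y;
  connectionDr : forall X Z1 Z2 Y,
    flag_field X -> flag_field Z1 -> flag_field Z2 -> stiefel Y ->
    nabla X (fun Y' => Z1 Y' + Z2 Y') Y = nabla X Z1 Y + nabla X Z2 Y;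
  connectionZl : forall f X Z Y,
    flag_function f -> flag_field X -> flag_field Z -> stiefel Y ->
    nabla (fun Y' => f Y' *: X Y') Z Y = f Y *: nabla X Z Y;
  connection_leibniz : forall f X Z Y,
    flag_function f -> flag_field X -> flag_field Z -> stiefel Y ->
    nabla X (fun Y' => f Y' *: Z Y') Y =
      'D_(X Y) f Y *: Z Y + f Y *: nabla X Z Y;
  connection_torsion_free : forall X Z Y,
    flag_field X -> flag_field Z -> stiefel Y ->
    vertical Y (lie_bracket X Z Y - (nabla X Z Y - nabla Z X Y));
  connection_metric : forall X Z W Y,
    flag_field X -> flag_field Z -> flag_field W -> stiefel Y ->
    'D_(X Y) (fun Y' => metric alpha Y' (Z Y') (W Y')) Y =
      metric alpha Y (nabla X Z Y) (W Y) + metric alpha Y (Z Y) (nabla X W Y)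
}.

Definition horizontal_curve (gamma : R -> mat) : Prop :=
  forall t, [/\ stiefel (gamma t), derivable gamma t 1 &
                horizontal (gamma t) (derive1 gamma t)].

(* E is the covariant derivative of Delta along gamma: if
   Delta = \sum_i f_i (X_i \o gamma), then
   E = \sum_i f_i' (X_i \o gamma) + f_i nabla_(gamma') X_i.  As nabla acts on
   fields, for each t the vector gamma'(t) is extended to a field V t, the
   choice of which is immaterial by tensoriality. *)
Definition covariant_derivative
    (nabla : (mat -> mat) -> (mat -> mat) -> (mat -> mat))
    (gamma Delta E : R -> mat) : Prop :=
  exists (m : nat) (f : 'I_m -> R -> R) (X : 'I_m -> mat -> mat)
         (V : R -> mat -> mat),
  [/\ forall i, flag_field (X i) /\ (forall t, derivable (f i) t 1),
      forall t, flag_field (V t) /\ V t (gamma t) = derive1 gamma t,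
      forall t, Delta t = \sum_i f i t *: X i (gamma t) &
      forall t, E t = \sum_i (derive1 (f i) t *: X i (gamma t) +
                              f i t *: nabla (V t) (X i) (gamma t))].

Definition parallel (nabla : (mat -> mat) -> (mat -> mat) -> (mat -> mat))
    (gamma Delta : R -> mat) : Prop :=
  covariant_derivative nabla gamma Delta (fun=> 0).

(* gamma is the horizontal lift, starting at Y, of the geodesic whose initial
   velocity is lifted by xi. *)
Definition geodesic_lift
    (nabla : (mat -> mat) -> (mat -> mat) -> (mat -> mat))
    (Y xi : mat) (gamma : R -> mat) : Prop :=
  [/\ horizontal_curve gamma, parallel nabla gamma (derive1 gamma),
      gamma 0 = Y & derive1 gamma 0 = xi].

Definition parallel_transport_lift
    (nabla : (mat -> mat) -> (mat -> mat) -> (mat -> mat))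
    (gamma : R -> mat) (eta : mat) (Delta : R -> mat) : Prop :=
  parallel nabla gamma Delta /\ Delta 0 = eta.

Definition skew_part (m : nat) (M : 'M[R]_m) : 'M[R]_m := 2^-1 *: (M - M^T).

Definition proj_m (M : 'M[R]_d) : 'M[R]_d :=
  \mxblock_(i < p, j < p) (if i == j then 0 else submxblock M i j).

(* Defined by the same formula on all (d + k) x d matrices; the subspace of
   the W whose upper block is antisymmetric with zero flag diagonal blocks is
   stable under it. *)
Definition transport_op (k : nat) (A : 'M[R]_d) (B : 'M[R]_(k, d))
    (W : 'M[R]_(d + k, d)) : 'M[R]_(d + k, d) :=
  let Wa := usubmx W in
  let Wr := dsubmx W in
  col_mx (proj_m (skew_part (Wa *m A + B^T *m Wr)))
         (2^-1 *: (Wr *m A - B *m Wa)).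

End Flag.

(* Main.v *)
Require Import Defs.
From HB Require Import structures.
From mathcomp Require Import all_boot all_order all_algebra.
From mathcomp Require Import lra.
From mathcomp Require Import all_classical all_reals all_analysis.
Import Order.TTheory GRing.Theory Num.Theory.
Import numFieldNormedType.Exports.
Local Open Scope ring_scope.

Set Implicit Arguments.
Unset Strict Implicit.
Unset Printing Implicit Defensive.

(** For alpha = 1/2 the metric of the flag manifold is naturally reductive, and
    the connection has a closed form.  Write H_Y for the projection onto the
    horizontal space at Y that discards the symmetric part and the diagonal
    blocks of the component along Y.  For lifted fields X and Z,
    [nabla_X Z = H_Y (D_X Z) - C_Y (X, Z)] with
    [C_Y (X, Z) = 1/2 (1 - Y Y^T) (X Y^T Z + Z Y^T X)]  (levi_civitaE).
    Indeed the right-hand side satisfies the metric identity and has the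
    right torsion, so its difference with nabla gives a trilinear form that is
    symmetric in two arguments and antisymmetric in two others, hence zero.
    The test fields that this requires are the horizontal parts of Y |-> Om Y,
    for n x n matrices Om: they are invariant and take all the horizontal
    values at each point (frame_flag_field, frame_field_value).

    Since these fields also frame every curve, a field D along a horizontal
    curve g is parallel if and only if it is horizontal and solves
    [H_g (D') = C_g (g', D)]  (parallelP).  Such a D is determined by its
    initial value, because the metric is constant on differences of parallel
    fields (parallel_unique).

    When g is a geodesic, the antisymmetric matrix
    [Om = g' g^T - g g'^T - g g^T g' g^T], the momentum of the motion for the
    action of O(n), is constant and g' = Om g (geodesic_momentum).  This linear
    equation determines g.  At t = 0, Om is [Y|Q] V [Y|Q]^T with
    V = [A, -B^T; B, 0], hence g is the first block of columns of the frame
    G = [Y|Q] expm (t V), which has orthonormal columns and satisfies G' = G V.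

    Look for parallel fields of the form D = G w + E e, where E is the part
    of eta orthogonal to Y and Q.  The coefficients of the equation do not
    depend on t in the frame G, and the equation splits into w' = P w, with P
    the operator of the statement, and e' = e A / 2 (transport_equation).  Its
    solution is w = e^(t P) ([Y|Q]^T eta) and e = expm (t A / 2). *)

(** * Calculus of matrix-valued maps *)

Section MatrixCalculus.
Local Open Scope classical_set_scope.
Variable R : realType.

Section Derive.
Variable V : normedModType R.
Implicit Types x v : V.

Lemma is_derive_mxP m n (M : V -> 'M[R]_(m, n)) x v dM :
  is_derive x v M dM <->
  forall i j, is_derive x v (fun y => M y i j) (dM i j).
Proof.
split=> [dMx i j | dMij].
  apply: DeriveDef.
    by have [/derivable_mxP + _] := dMx; apply.
  by have [dv <-] := dMx; rewrite derive_mx // mxE.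
have dv : derivable M x v by apply/derivable_mxP => i j; have [] := dMij i j.
apply: DeriveDef => //; rewrite derive_mx //; apply/matrixP=> i j.
by rewrite mxE; have [_ ->] := dMij i j.
Qed.

Lemma is_derive_big (W : normedModType R) (I : finType) (f : I -> V -> W) df
    x v :
  (forall i, is_derive x v (f i) (df i)) ->
  is_derive x v (fun y => \sum_i f i y) (\sum_i df i).
Proof.
move=> fP; have -> : (fun y => \sum_i f i y) = \sum_i f i.
  by apply/funext => y; rewrite fct_sumE.
elim/big_ind2: _ => [|g dg h dh gP hP|i _]; last exact: fP.
  exact: is_derive_cst.
exact: is_deriveD.
Qed.

Lemma is_deriveZl (W : normedModType R) (f : V -> R) (w : W) x v df :
  is_derive x v f df -> is_derive x v (fun y => f y *: w) (df *: w).
Proof.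
case=> dv <-.
suff H : h^-1 *: ((f (h *: v + x) *: w) - f x *: w) @[h --> 0^'] -->
    'D_v f x *: w.
  by apply: DeriveDef; [apply/cvg_ex; eexists; exact: H | exact/cvg_lim].
under eq_fun do rewrite -scalerBl scalerA.
apply: cvgZr_tmp; exact: dv.
Qed.

Lemma is_derive_mxlin m n (W : normedModType R) (L : 'M[R]_(m, n) -> W)
    (F : V -> 'M[R]_(m, n)) x v dF :
  linear L -> is_derive x v F dF -> is_derive x v (fun y => L (F y)) (L dF).
Proof.
move=> linL /is_derive_mxP dFij.
pose Ll : {linear _ -> _} := HB.pack L (GRing.isLinear.Build _ _ _ _ L linL).
have LE M : L M = \sum_i \sum_j M i j *: L (delta_mx i j).
  rewrite [in LHS](matrix_sum_delta M) -[L]/(Ll : _ -> _) linear_sum.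
  apply: eq_bigr=> i _; rewrite linear_sum.
  by apply: eq_bigr=> j _; rewrite linearZ.
rewrite LE; under eq_fun do rewrite LE.
do 2! apply: is_derive_big => ?; exact: is_deriveZl.
Qed.

Lemma is_derive_mulmx m n p (F : V -> 'M[R]_(m, n)) (G : V -> 'M[R]_(n, p))
    x v dF dG :
  is_derive x v F dF -> is_derive x v G dG ->
  is_derive x v (fun y => F y *m G y) (dF *m G x + F x *m dG).
Proof.
move=> /is_derive_mxP dFij /is_derive_mxP dGij; apply/is_derive_mxP=> i j.
under eq_fun do rewrite mxE.
rewrite !mxE -big_split; apply: is_derive_big => k.
apply: is_derive_eq (is_deriveM (dFij i k) (dGij k j)) _.
by rewrite addrC /GRing.scale /= [G x k j * _]mulrC.
Qed.

Lemma is_derive_scalemx m n (f : V -> R) (G : V -> 'M[R]_(m, n)) x v df dG :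
  is_derive x v f df -> is_derive x v G dG ->
  is_derive x v (fun y => f y *: G y) (df *: G x + f x *: dG).
Proof.
move=> dfx /is_derive_mxP dGij; apply/is_derive_mxP=> i j.
under eq_fun do rewrite mxE.
apply: is_derive_eq (is_deriveM dfx (dGij i j)) _.
by rewrite !mxE addrC /GRing.scale /= [G x i j * _]mulrC.
Qed.

Lemma is_deriveMx m n p (F : V -> 'M[R]_(m, n)) (C : 'M[R]_(n, p)) x v dF :
  is_derive x v F dF -> is_derive x v (fun y => F y *m C) (dF *m C).
Proof.
apply: (is_derive_mxlin (L := mulmx^~ C)) => a A N.
by rewrite mulmxDl scalemxAl.
Qed.

Lemma is_derivexM m n p (C : 'M[R]_(m, n)) (F : V -> 'M[R]_(n, p)) x v dF :
  is_derive x v F dF -> is_derive x v (fun y => C *m F y) (C *m dF).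
Proof.
by apply: (is_derive_mxlin (L := mulmx C)) => a A B; rewrite mulmxDr scalemxAr.
Qed.

Lemma is_derive_tr m n (F : V -> 'M[R]_(m, n)) x v dF :
  is_derive x v F dF -> is_derive x v (fun y => (F y)^T) dF^T.
Proof.
apply: (is_derive_mxlin (L := @trmx R m n)) => a A B; exact: linearP.
Qed.

Lemma is_derive_mxtrace n (F : V -> 'M[R]_n) x v dF :
  is_derive x v F dF -> is_derive x v (fun y => \tr (F y)) (\tr dF).
Proof.
apply: (is_derive_mxlin (W := R^o) (L := fun A => \tr A)) => a A B.
by rewrite linearP.
Qed.

End Derive.

Lemma is_derive1P m n (F : R -> 'M[R]_(m, n)) t dF :
  is_derive t (1 : R) F dF <-> derivable F t 1 /\ derive1 F t = dF.
Proof. by rewrite derive1E; split; case. Qed.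

Lemma is_derive_diff (V W : normedModType R) (f : V -> W) x v :
  differentiable f x -> is_derive x v f ('D_v f x).
Proof. by move=> /diff_derivable df; exact: derivableP. Qed.

Lemma is_derive_chain (V W : normedModType R) (c : R -> V) (f : V -> W) t dc :
  is_derive t (1 : R) c dc -> differentiable f (c t) ->
  is_derive t (1 : R) (fun s => f (c s)) ('D_dc f (c t)).
Proof.
move=> [/derivable1_diffP dct <-] df.
have dfc : differentiable (f \o c) t by exact: differentiable_comp.
apply: DeriveDef; first exact: diff_derivable.
rewrite -[fun s => _]/(f \o c) deriveE // diff_comp //= deriveE //.
by rewrite deriveE.
Qed.

Lemma mx_curve_cst m n (F : R -> 'M[R]_(m, n)) :
  (forall t, is_derive t (1 : R) F 0) -> forall t, F t = F 0.
Proof.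
move=> dF t; apply/matrixP=> i j.
apply: (is_derive_0_is_cst (f := fun s => F s i j)) => s.
by have /is_derive_mxP/(_ i j) := dF s; rewrite mxE.
Qed.

Section Smooth.
Variable V : normedModType R.

Lemma differentiable_mx m n (M : V -> 'M[R]_(m, n)) x :
  (forall i j, differentiable (fun y => M y i j) x) -> differentiable M x.
Proof.
move=> dM.
have -> : M = \sum_i \sum_j (fun y => M y i j *: delta_mx i j).
  apply/funext=> y; rewrite {1}(matrix_sum_delta (M y)) fct_sumE.
  by apply: eq_bigr=> i _; rewrite fct_sumE.
do 2! (apply: differentiable_sum => ?); exact: differentiableZl.
Qed.

Lemma differentiable_entry m n (M : V -> 'M[R]_(m, n)) x i j :
  differentiable M x -> differentiable (fun y => M y i j) x.
Proof.
move=> dM; exact: (differentiable_comp dM (differentiable_coord (M x) i j)).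
Qed.

Lemma differentiable_mulmx m n p (F : V -> 'M[R]_(m, n))
    (G : V -> 'M[R]_(n, p)) x :
  differentiable F x -> differentiable G x ->
  differentiable (fun y => F y *m G y) x.
Proof.
move=> dF dG; apply: differentiable_mx => i j.
have -> : (fun y => (F y *m G y) i j) = \sum_k (fun y => F y i k * G y k j).
  by apply/funext=> y; rewrite mxE fct_sumE.
apply: differentiable_sum => k.
by apply: differentiableM; exact: differentiable_entry.
Qed.

Lemma differentiable_mxlin m n p q (L : 'M[R]_(m, n) -> 'M[R]_(p, q))
    (F : V -> 'M[R]_(m, n)) x :
  linear L -> differentiable F x -> differentiable (fun y => L (F y)) x.
Proof.
move=> linL dF.
pose Ll : {linear _ -> _} := HB.pack L (GRing.isLinear.Build _ _ _ _ L linL).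
have -> : (fun y => L (F y)) =
    \sum_i \sum_j (fun y => F y i j *: L (delta_mx i j)).
  apply/funext=> y; rewrite [in LHS](matrix_sum_delta (F y)).
  rewrite -[L]/(Ll : _ -> _) linear_sum fct_sumE.
  apply: eq_bigr=> i _; rewrite linear_sum fct_sumE.
  by apply: eq_bigr=> j _; rewrite linearZ.
do 2! (apply: differentiable_sum => ?); apply: differentiableZl.
exact: differentiable_entry.
Qed.

(** The inductions on the order of differentiation are made under hypotheses
    [smooth f], which are stable under differentiation, whereas
    [iter_differentiable r f] loses one order at each step. *)
Lemma smoothS (W : normedModType R) (f : V -> W) :
  smooth f <->
  (forall x, differentiable f x) /\ forall v, smooth (fun x => 'D_v f x).
Proof.
split=> [sf | [df sf] [|m]]; last by split => // v; exact: sf.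
  by split=> [|v m]; [have [] := sf 1%N | have [_] := sf m.+1; apply].
by move=> x; exact: differentiable_continuous.
Qed.

Lemma smooth_diff (W : normedModType R) (f : V -> W) x :
  smooth f -> differentiable f x.
Proof. by case/smoothS. Qed.

Lemma smooth_cst (W : normedModType R) (w : W) : smooth (fun _ : V => w).
Proof.
move=> m; elim: m w => [|m IH] w; first by move=> x; exact: cvg_cst.
split=> [x|v]; first exact: differentiable_cst.
by under eq_fun do rewrite derive_cst; exact: IH.
Qed.

Lemma smooth_id : smooth (id : V -> V).
Proof.
apply/smoothS; split=> [x|v]; first exact: ex_diff.
under eq_fun do rewrite derive_id; exact: smooth_cst.
Qed.

Lemma iter_differentiableD (W : normedModType R) r (f g : V -> W) :
  iter_differentiable r f -> iter_differentiable r g ->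
  iter_differentiable r (fun x => f x + g x).
Proof.
elim: r f g => [|r IH] f g.
  by move=> cf cg x; apply: cvgD; [exact: cf | exact: cg].
move=> [df sf] [dg sg]; split=> [x|v]; first exact: differentiableD.
rewrite (_ : (fun x => _) = fun x => 'D_v f x + 'D_v g x).
  exact: IH (sf v) (sg v).
by apply/funext=> x; rewrite deriveD //; exact: diff_derivable.
Qed.

Lemma smoothD (W : normedModType R) (f g : V -> W) :
  smooth f -> smooth g -> smooth (fun x => f x + g x).
Proof. by move=> sf sg r; exact: iter_differentiableD. Qed.

Lemma smooth_mxlin m n p q (L : 'M[R]_(m, n) -> 'M[R]_(p, q))
    (F : V -> 'M[R]_(m, n)) :
  linear L -> smooth F -> smooth (fun x => L (F x)).
Proof.
move=> linL sF r; elim: r F sF => [|r IH] F /smoothS[dF sF].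
  by move=> x; apply/differentiable_continuous/differentiable_mxlin.
split=> [x|v]; first exact: differentiable_mxlin.
rewrite (_ : (fun x => _) = fun x => L ('D_v F x)); first exact: IH.
apply/funext=> x; apply: derive_val.
by apply: is_derive_mxlin => //; exact: is_derive_diff.
Qed.

Lemma smooth_mulmx m n p (F : V -> 'M[R]_(m, n)) (G : V -> 'M[R]_(n, p)) :
  smooth F -> smooth G -> smooth (fun x => F x *m G x).
Proof.
move=> sF sG r.
elim: r F G sF sG => [|r IH] F G /smoothS[dF sF] /smoothS[dG sG].
  by move=> x; apply/differentiable_continuous/differentiable_mulmx.
split=> [x|v]; first exact: differentiable_mulmx.
rewrite (_ : (fun x => _) = fun x => 'D_v F x *m G x + F x *m 'D_v G x).
  by apply: iter_differentiableD; apply: IH => //; apply/smoothS.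
apply/funext=> x; apply: derive_val.
by apply: is_derive_mulmx; exact: is_derive_diff.
Qed.

End Smooth.
End MatrixCalculus.

(** * Exponential of a linear operator on matrices *)

Section Exponential.
Local Open Scope classical_set_scope.
Variables (R : realType) (m q : nat) (L : 'M[R]_(m, q) -> 'M[R]_(m, q)).
Hypothesis linL : linear L.

Lemma cvg_mx (u : nat -> 'M[R]_(m, q)) (l : 'M[R]_(m, q)) :
  (forall i j, (fun k => u k i j) @ \oo --> l i j) -> u @ \oo --> l.
Proof.
move=> ul; apply/cvgrPdist_le => /= e e0; near=> k.
rewrite /Num.Def.normr/= mx_normrE (bigmax_le _ (ltW e0))//= => i _.
rewrite !mxE /=.
move: i; near: k; apply: filter_forall => /= i.
exact: ((cvgrPdist_le _ _).1 (ul i.1 i.2)).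
Unshelve. all: by end_near. Qed.

Lemma mx_entry_le_norm (M : 'M[R]_(m, q)) i j : `|M i j| <= `|M|.
Proof.
rewrite [leRHS]/Num.Def.normr/= mx_normrE.
exact: (le_bigmax _ (fun ij => `|M ij.1 ij.2|) (i, j)).
Qed.

Let linLP : {linear 'M[R]_(m, q) -> 'M[R]_(m, q)} :=
  HB.pack L (GRing.isLinear.Build _ _ _ _ L linL).

Lemma mxlin_continuous : continuous L.
Proof.
move=> M; apply: differentiable_continuous.
exact: (differentiable_mxlin (F := id) linL).
Qed.

Lemma iter_mxlin_bound (v : 'M[R]_(m, q)) :
  exists2 C, 0 < C & forall i, `|iter i L v| <= C ^+ i * `|v|.
Proof.
have [C C0 LC] := @linear_lipschitz _ _ _ linLP mxlin_continuous.
exists C => //; elim=> [|i IH]; first by rewrite mul1r.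
by rewrite iterS exprS -mulrA (le_trans (LC _)) // ler_wpM2l // ltW.
Qed.

Let coef (v : 'M[R]_(m, q)) a b i : R := i`!%:R^-1 * (iter i L v) a b.

(** Term-by-term differentiation replaces v by L v. *)
Lemma coef_diffs v a b : pseries_diffs (coef v a b) = coef (L v) a b.
Proof.
apply/funext=> i; rewrite /pseries_diffs /coef factS natrM invfM.
by rewrite !mulrA mulfV ?mul1r ?pnatr_eq0 // -iterSr.
Qed.

Lemma cvg_coef v a b t : cvgn (pseries (coef v a b) t).
Proof.
have [C C0 LC] := iter_mxlin_bound v.
apply: normed_cvg; rewrite /normed_series_of /=.
apply: (@series_le_cvg _ _ (fun i => `|v| * exp_coeff (C * `|t|) i)).
- by move=> i; exact: normr_ge0.
- move=> i; apply: mulr_ge0 => //; apply: exp_coeff_ge0.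
  by rewrite mulr_ge0 // ltW.
- move=> i.
  have -> : `|coef v a b i * t ^+ i| =
      `|(iter i L v) a b| * (`|t| ^+ i / i`!%:R).
    by rewrite /coef !normrM normfV normr_nat normrX mulrAC mulrC
      [_^-1 * _]mulrC.
  have -> : `|v| * exp_coeff (C * `|t|) i =
      C ^+ i * `|v| * (`|t| ^+ i / i`!%:R).
    by rewrite /exp_coeff /= exprMn !mulrA [`|v| * _]mulrC.
  apply: ler_wpM2r; first by rewrite divr_ge0 // exprn_ge0.
  exact: le_trans (mx_entry_le_norm _ _ _) (LC i).
- by apply: is_cvg_seriesZ; exact: is_cvg_series_exp_coeff.
Qed.

Lemma iter_scale_mxlin t v i :
  iter i (fun W => t *: L W) v = t ^+ i *: iter i L v.
Proof.
elim: i => [|i IH]; first by rewrite scale1r.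
by rewrite !iterS IH -[L]/(linLP : _ -> _) linearZ scalerA exprS.
Qed.

Lemma cvg_expv t v :
  series (fun i => (i`!%:R)^-1 *: iter i (fun W => t *: L W) v) @ \oo -->
  expv (fun W => t *: L W) v /\
  forall a b, (expv (fun W => t *: L W) v) a b = limn (pseries (coef v a b) t).
Proof.
set u := series _; pose l := \matrix_(a, b) limn (pseries (coef v a b) t).
have ul : u @ \oo --> l.
  apply: cvg_mx => a b; rewrite mxE.
  have -> : (fun k => u k a b) = pseries (coef v a b) t; last exact: cvg_coef.
  apply/funext=> k; rewrite /u /pseries /series /= summxE.
  apply: eq_bigr => i _; rewrite iter_scale_mxlin /coef !mxE.
  by rewrite [t ^+ i * _]mulrC mulrA.
have ue : expv (fun W => t *: L W) v = l by exact: cvg_lim.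
by rewrite ue; split=> // a b; rewrite mxE.
Qed.

Lemma expv_lin t v :
  expv (fun W => t *: L W) (L v) = L (expv (fun W => t *: L W) v).
Proof.
have [cv _] := cvg_expv t v; apply: cvg_lim => //.
rewrite (_ : series _ =
    L \o series (fun i => (i`!%:R)^-1 *: iter i (fun W => t *: L W) v)).
  exact: cvg_comp cv (@mxlin_continuous _).
apply/funext=> k; rewrite /= /series /= -[L]/(linLP : _ -> _) linear_sum.
apply: eq_bigr => i _; rewrite linearZ; congr (_ *: _).
elim: i => // i IH; rewrite !iterS IH /=.
by rewrite -[L]/(linLP : _ -> _) linearZ.
Qed.

(** The entries of e^(t L) v are power series in t, whose coefficients are
    bounded by those of an exponential series; the real theory of power series
    then gives convergence and differentiability entry by entry. *)
Lemma is_derive_expv t v :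
  is_derive t (1 : R) (fun s => expv (fun W => s *: L W) v)
    (L (expv (fun W => t *: L W) v)).
Proof.
apply/is_derive_mxP => a b; rewrite -expv_lin.
rewrite (cvg_expv t (L v)).2; under eq_fun do rewrite (cvg_expv _ v).2.
rewrite -coef_diffs; apply: (@pseries_snd_diffs _ _ (`|t| + 1)).
- exact: cvg_coef.
- by rewrite coef_diffs; exact: cvg_coef.
- by rewrite !coef_diffs; exact: cvg_coef.
- by rewrite ltr_normr ltrDl ltr01.
Qed.

Lemma expv0 v : expv (fun W => 0 *: L W) v = v.
Proof.
apply: cvg_lim => //; apply/cvg_ballP => e e0; near=> k.
rewrite (_ : series _ k = v); first exact: ballxx.
have -> : k = k.-1.+1 by rewrite prednK //; near: k; exact: nbhs_infty_gt.
rewrite /series /= big_nat_recl //= fact0 invr1 scale1r big1 ?addr0 // => i _.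
by rewrite scale0r scaler0.
Unshelve. all: by end_near. Qed.

End Exponential.

Section MatrixExponential.
Variables (R : realType) (m : nat) (A : 'M[R]_m).

Let linl : linear (fun W : 'M[R]_m => A *m W).
Proof. by move=> a M N; rewrite mulmxDr scalemxAr. Qed.

Let linr : linear (fun W : 'M[R]_m => W *m A).
Proof. by move=> a M N; rewrite mulmxDl scalemxAl. Qed.

(** The matrix exponential is the case of left or right multiplication by A
    applied to the identity; the two forms give the two expressions of its
    derivative. *)
Lemma expm_expvl t : expm (t *: A) = expv (fun W => t *: (A *m W)) 1%:M.
Proof.
rewrite /expm /expv; congr (limn (series _)); apply/funext=> i; congr (_ *: _).
elim: i => [|i IH]; first by rewrite expr0.
by rewrite iterS -IH exprS -mulmxE scalemxAl.
Qed.

Lemma expm_expvr t : expm (t *: A) = expv (fun W => t *: (W *m A)) 1%:M.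
Proof.
rewrite /expm /expv; congr (limn (series _)); apply/funext=> i; congr (_ *: _).
elim: i => [|i IH]; first by rewrite expr0.
by rewrite iterS -IH exprSr -mulmxE scalemxAr.
Qed.

Lemma is_derive_expml t :
  is_derive t (1 : R) (fun s => expm (s *: A)) (A *m expm (t *: A)).
Proof.
rewrite expm_expvl; under eq_fun do rewrite expm_expvl.
exact: (is_derive_expv linl).
Qed.

Lemma is_derive_expmr t :
  is_derive t (1 : R) (fun s => expm (s *: A)) (expm (t *: A) *m A).
Proof.
rewrite expm_expvr; under eq_fun do rewrite expm_expvr.
exact: (is_derive_expv linr).
Qed.

Lemma expm0 : expm (0 *: A) = 1%:M.
Proof. by rewrite expm_expvl expv0. Qed.

Lemma expm_orthogonal t :
  A^T = - A -> (expm (t *: A))^T *m expm (t *: A) = 1%:M.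
Proof.
move=> At; have <- : (expm (0 *: A))^T *m expm (0 *: A) = 1%:M.
  by rewrite expm0 trmx1 mulmx1.
apply: (mx_curve_cst (F := fun s => (expm (s *: A))^T *m expm (s *: A))) => s.
have dE := is_derive_expml s.
apply: is_derive_eq (is_derive_mulmx (is_derive_tr dE) dE) _.
by rewrite trmx_mul At mulmxN mulNmx mulmxA addNr.
Qed.

End MatrixExponential.

(** * Antisymmetric matrices with zero flag diagonal blocks *)

Section FlagProjection.
Variables (R : realType) (p : nat) (d_ : 'I_p -> nat).
Local Notation d := (\sum_i d_ i)%N.
Implicit Types M N W : 'M[R]_d.

Lemma proj_mE M s t :
  proj_m M s t = if tagnat.sig1 s == tagnat.sig1 t then 0 else M s t.
Proof.
by rewrite !mxE; case: ifP => _; rewrite !mxE //= !tagnat.sig2K.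
Qed.

Lemma submxblock_proj_m M i : submxblock (proj_m M) i i = 0.
Proof. by rewrite mxblockK eqxx. Qed.

Lemma proj_m_id M : (forall i, submxblock M i i = 0) -> proj_m M = M.
Proof.
move=> M0; rewrite -[RHS]submxblockK; apply/eq_mxblock=> i j.
by case: eqVneq => // <-; rewrite M0.
Qed.

Lemma proj_m_tr M : proj_m M^T = (proj_m M)^T.
Proof. by apply/matrixP=> s t; rewrite [RHS]mxE !proj_mE eq_sym mxE. Qed.

Fact proj_m_is_linear : linear (@proj_m R p d_).
Proof.
move=> a M N; apply/matrixP=> s t.
rewrite proj_mE [RHS]mxE [X in _ = X + _]mxE !proj_mE !mxE.
by case: ifP => _; rewrite ?mulr0 ?addr0.
Qed.

HB.instance Definition _ :=
  GRing.isLinear.Build R 'M[R]_d 'M[R]_d _ (@proj_m R p d_) proj_m_is_linear.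

Lemma proj_m_mxdiag (B : forall i, 'M[R]_(d_ i)) : proj_m (\mxdiag_i B i) = 0.
Proof.
rewrite -(mxblock0 (p_ := d_) (q_ := d_)).
by apply/eq_mxblock=> i j; case: eqVneq => // /negPf ij; rewrite mxblockK ij.
Qed.

Lemma proj_m_conj (B : forall i, 'M[R]_(d_ i)) M :
  let U := \mxdiag_i B i in
  proj_m (U^T *m M *m U) = U^T *m proj_m M *m U.
Proof.
move=> U; rewrite /U tr_mxdiag -{1}(submxblockK M) !mul_mxdiag_mxblock.
rewrite !mul_mxblock_mxdiag; apply/eq_mxblock=> i j.
by rewrite mxblockK; case: eqVneq; rewrite ?mulmx0 ?mul0mx.
Qed.

Lemma proj_m_adjoint M N : \tr ((proj_m M)^T *m N) = \tr (M^T *m proj_m N).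
Proof.
rewrite /mxtrace; apply: eq_bigr => s _; rewrite !mxE; apply: eq_bigr => t _.
rewrite [X in X * _]mxE [X in _ = X * _]mxE !proj_mE.
by case: ifP; rewrite ?mul0r ?mulr0.
Qed.

(** The trace-orthogonal projection onto the matrices Y^T xi of the horizontal
    vectors xi, that is, the complement in so(d) of the block diagonal ones. *)
Definition flag_skew M : 'M[R]_d := proj_m (skew_part M).

Fact flag_skew_is_linear : linear flag_skew.
Proof.
move=> a M N; rewrite /flag_skew -linearP; congr proj_m.
rewrite /skew_part linearP /= opprD addrACA scalerDr; congr (_ + _).
by rewrite -scalerBr !scalerA mulrC.
Qed.

HB.instance Definition _ :=
  GRing.isLinear.Build R 'M[R]_d 'M[R]_d _ flag_skew flag_skew_is_linear.

Lemma flag_skew_tr M : (flag_skew M)^T = - flag_skew M.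
Proof.
rewrite /flag_skew -proj_m_tr -linearN; congr proj_m.
by rewrite /skew_part linearZ linearB /= trmxK -scalerN opprB.
Qed.

Lemma submxblock_flag_skew M i : submxblock (flag_skew M) i i = 0.
Proof. exact: submxblock_proj_m. Qed.

Lemma flag_skew_id M :
  M^T = - M -> (forall i, submxblock M i i = 0) -> flag_skew M = M.
Proof.
move=> Mt M0; rewrite -[RHS]proj_m_id // /flag_skew /skew_part; congr proj_m.
by rewrite Mt opprK scalerDr -scalerDl -[_^-1]mul1r -splitr scale1r.
Qed.

Lemma flag_skewK M : flag_skew (flag_skew M) = flag_skew M.
Proof. exact: (flag_skew_id (flag_skew_tr M) (submxblock_flag_skew M)). Qed.

Lemma flag_skew_sym M : M^T = M -> flag_skew M = 0.
Proof.
move=> Mt; rewrite /flag_skew /skew_part Mt subrr scaler0.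
exact: linear0.
Qed.

Lemma flag_skew_mxdiag (B : forall i, 'M[R]_(d_ i)) :
  flag_skew (\mxdiag_i B i) = 0.
Proof.
rewrite /flag_skew /skew_part tr_mxdiag -mxdiagB.
by rewrite linearZ /= proj_m_mxdiag scaler0.
Qed.

(** Block diagonal matrices preserve the off-diagonal pattern; this is what
    makes the horizontal projection equivariant. *)
Lemma flag_skew_conj U M :
  flag_group U -> flag_skew (U^T *m M *m U) = U^T *m flag_skew M *m U.
Proof.
case=> B _ ->; rewrite /flag_skew -proj_m_conj; congr proj_m.
rewrite /skew_part !trmx_mul trmxK -scalemxAr -scalemxAl; congr (_ *: _).
by rewrite mulmxBr mulmxBl mulmxA.
Qed.

Lemma flag_skew_adjoint M W :
  flag_skew W = W -> \tr ((flag_skew M)^T *m W) = \tr (M^T *m W).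
Proof.
move=> WE; have Wt : W^T = - W by rewrite -WE flag_skew_tr.
have Wm : proj_m W = W.
  by apply: proj_m_id => i; rewrite -WE submxblock_flag_skew.
rewrite /flag_skew proj_m_adjoint Wm /skew_part linearZ linearB /= trmxK.
rewrite -scalemxAl linearZ mulmxBl linearB /=.
rewrite -[\tr (M *m W)]mxtrace_tr trmx_mul Wt mulNmx linearN /= opprK.
rewrite [\tr (W *m _)]mxtrace_mulC -mulr2n -[\tr _ *+ 2]mulr_natl.
by rewrite mulKf // pnatr_eq0.
Qed.

End FlagProjection.

(** * Horizontal projection and quotient metric *)

Section TraceSquare.
Variables (R : realType) (q r : nat) (A : 'M[R]_(q, r)).

Lemma mxtrace_sqE : \tr (A^T *m A) = \sum_i \sum_j A j i ^+ 2.
Proof.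
rewrite /mxtrace; apply: eq_bigr => i _; rewrite mxE.
by apply: eq_bigr => j _; rewrite mxE.
Qed.

Lemma mxtrace_sq_ge0 : 0 <= \tr (A^T *m A).
Proof.
by rewrite mxtrace_sqE; do 2! (apply: sumr_ge0 => ? _); exact: sqr_ge0.
Qed.

Lemma mxtrace_sq_eq0 : \tr (A^T *m A) = 0 -> A = 0.
Proof.
rewrite mxtrace_sqE => /eqP; rewrite psumr_eq0 => [/allP A0|i _]; last first.
  by apply: sumr_ge0 => ? _; exact: sqr_ge0.
apply/matrixP=> j i; rewrite mxE; apply/eqP.
have := A0 i; rewrite mem_index_enum => /(_ isT).
rewrite psumr_eq0 => [/allP/(_ j)|l _]; last exact: sqr_ge0.
by rewrite mem_index_enum sqrf_eq0; apply.
Qed.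

End TraceSquare.

Section HorizontalGeometry.
Variables (R : realType) (n p : nat) (d_ : 'I_p -> nat).
Local Notation d := (\sum_i d_ i)%N.
Local Notation mat := 'M[R]_(n, d).
Implicit Types (Y M X Z W : mat).

Lemma horizontalP Y M :
  horizontal Y M <-> flag_skew (Y^T *m M) = Y^T *m M.
Proof.
split=> [[Mt M0] | ME]; first exact: flag_skew_id.
split=> [|i]; first by rewrite -ME flag_skew_tr.
by rewrite -ME submxblock_flag_skew.
Qed.

Lemma horizontal_tr Y M : horizontal Y M -> M^T *m Y = - (Y^T *m M).
Proof. by case=> <- _; rewrite trmx_mul trmxK. Qed.

Lemma flag_group_orthogonal (U : 'M[R]_d) : flag_group U -> U *m U^T = 1%:M.
Proof.
case=> B BB ->; apply: mulmx1C; rewrite tr_mxdiag {2}/mxdiag.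
rewrite mul_mxdiag_mxblock -mxdiagZ /mxdiag.
apply/eq_mxblock=> i j; case: eqVneq => [<-|_]; last by rewrite mulmx0.
by rewrite !conform_mx_id BB.
Qed.

(** The orthogonal projection onto the horizontal space, for the metric at Y;
    it kills the directions normal to the Stiefel manifold and the vertical
    ones. *)
Definition hproj Y M : mat :=
  M - Y *m (Y^T *m M) + Y *m flag_skew (Y^T *m M).

Fact hproj_is_linear Y : linear (hproj Y).
Proof.
move=> a M N; rewrite /hproj !(mulmxDr, linearP, =^~ scalemxAr) /=.
by rewrite (addrACA (a *: M)) [LHS]addrACA !scalerDr.
Qed.

HB.instance Definition _ Y :=
  GRing.isLinear.Build R mat mat _ (hproj Y) (hproj_is_linear Y).

Lemma tr_mul_hproj Y M :
  stiefel Y -> Y^T *m hproj Y M = flag_skew (Y^T *m M).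
Proof.
move=> YY; rewrite /hproj mulmxDr mulmxBr !(mulmxA Y^T Y) YY !mul1mx.
by rewrite subrr add0r.
Qed.

Lemma hproj_horizontal Y M : stiefel Y -> horizontal Y (hproj Y M).
Proof. by move=> YY; apply/horizontalP; rewrite tr_mul_hproj // flag_skewK. Qed.

Lemma hproj_id Y M : horizontal Y M -> hproj Y M = M.
Proof. by move/horizontalP=> ME; rewrite /hproj ME subrK. Qed.

Lemma hproj_vertical Y M : stiefel Y -> vertical Y M -> hproj Y M = 0.
Proof.
move=> YY [B _ ->]; rewrite /hproj (mulmxA Y^T) YY mul1mx.
by rewrite flag_skew_mxdiag mulmx0 subrr addr0.
Qed.

Lemma hproj_equivariant Y M U :
  flag_group U -> hproj (Y *m U) (M *m U) = hproj Y M *m U.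
Proof.
move=> Ugr; have UU := flag_group_orthogonal Ugr.
rewrite /hproj; have -> : (Y *m U)^T *m (M *m U) = U^T *m (Y^T *m M) *m U.
  by rewrite trmx_mul !mulmxA.
rewrite flag_skew_conj // mulmxDl mulmxBl.
by rewrite -!(mulmxA Y) !(mulmxA U) UU !mul1mx.
Qed.

Lemma metricC alpha Y M W : metric alpha Y M W = metric alpha Y W M.
Proof.
rewrite /metric -[\tr (M^T *m W)]mxtrace_tr -[X in _ + _ * X]mxtrace_tr.
by rewrite !trmx_mul !trmxK !mulmxA.
Qed.

Lemma metricBl alpha Y M N W :
  metric alpha Y (M - N) W = metric alpha Y M W - metric alpha Y N W.
Proof.
rewrite /metric [(M - N)^T]linearB /= !mulmxBl.
by rewrite [\tr (_ - _)]linearB [X in _ * X]linearB /= mulrBr opprD addrACA.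
Qed.

Lemma metricBr alpha Y M N W :
  metric alpha Y W (M - N) = metric alpha Y W M - metric alpha Y W N.
Proof. by rewrite metricC metricBl !(metricC _ _ W). Qed.

Lemma metric0l alpha Y W : metric alpha Y 0 W = 0.
Proof. by rewrite -(subrr (0 : mat)) metricBl subrr. Qed.

Lemma metric0r alpha Y W : metric alpha Y W 0 = 0.
Proof. by rewrite metricC metric0l. Qed.

Lemma metric_hproj Y M W : stiefel Y -> horizontal Y W ->
  metric 2^-1 Y (hproj Y M) W = metric 2^-1 Y M W.
Proof.
move=> YY /horizontalP WE; set N := Y^T *m M - flag_skew (Y^T *m M).
have -> : hproj Y M = M - Y *m N.
  by rewrite /hproj /N mulmxBr opprB addrA addrAC.
rewrite metricBl [X in _ - X](_ : _ = 0) ?subr0 //.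
have trN0 : \tr (N^T *m (Y^T *m W)) = 0.
  by rewrite /N linearB /= mulmxBl linearB /= flag_skew_adjoint // subrr.
rewrite /metric trmx_mul -!mulmxA trN0 add0r.
by rewrite (mulmxA Y^T Y) YY mul1mx trN0 mulr0.
Qed.

(** The metric is |N|^2 + |Y^T M|^2 / 2, where N = M - Y Y^T M. *)
Lemma metric_eq0 Y M : stiefel Y -> metric 2^-1 Y M M = 0 -> M = 0.
Proof.
move=> YY; set N := M - Y *m (Y^T *m M).
have NE : N^T *m N = M^T *m M - (Y^T *m M)^T *m (Y^T *m M).
  have -> : N^T = M^T - M^T *m Y *m Y^T.
    by rewrite /N [LHS]linearB /= !trmx_mul trmxK.
  rewrite /N mulmxBl !mulmxBr trmx_mul trmxK !mulmxA.
  by rewrite -(mulmxA _ Y^T Y) YY mulmx1 subrr subr0.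
have -> : metric 2^-1 Y M M =
    \tr (N^T *m N) + 2^-1 * \tr ((Y^T *m M)^T *m (Y^T *m M)).
  rewrite NE linearB /= /metric trmx_mul trmxK !mulmxA -addrA; congr (_ + _).
  by rewrite mulrBl mul1r addrC.
move=> /eqP; rewrite paddr_eq0 ?mulr_ge0 ?invr_ge0 ?mxtrace_sq_ge0 //.
move=> /andP[/eqP/mxtrace_sq_eq0 N0].
rewrite mulf_eq0 invr_eq0 pnatr_eq0 /= => /eqP/mxtrace_sq_eq0 YM0.
by move: N0; rewrite /N YM0 mulmx0 subr0.
Qed.

(** The horizontal part of the infinitesimal rotation Om.  It is polynomial and
    invariant under the block orthogonal group, which gives global fields with
    any prescribed horizontal value at a point. *)
Definition frame_field (Om : 'M[R]_n) Y : mat := hproj Y (Om *m Y).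

Lemma frame_field_value Y W :
  stiefel Y -> horizontal Y W -> frame_field (W *m Y^T) Y = W.
Proof. by move=> YY WH; rewrite /frame_field -mulmxA YY mulmx1 hproj_id. Qed.

Lemma frame_flag_field Om : flag_field (frame_field Om).
Proof.
split=> [|Y|Y U _ Ugr]; last 1 first.
- by rewrite /frame_field mulmxA hproj_equivariant.
- rewrite /frame_field /hproj.
  have sY := @smooth_id R mat.
  have sOY : smooth (fun Y : mat => Om *m Y).
    by apply: smooth_mulmx => //; exact: smooth_cst.
  have sYt : smooth (fun Y : mat => Y^T).
    by apply: (smooth_mxlin (L := trmx)) => // a A B; exact: linearP.
  have sYOY : smooth (fun Y : mat => Y^T *m (Om *m Y)) by exact: smooth_mulmx.
  apply: smoothD; last first.
    apply: smooth_mulmx => //.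
    exact: (smooth_mxlin (@flag_skew_is_linear _ _ _) sYOY).
  apply: smoothD => //; apply: (smooth_mxlin (L := -%R)).
    by move=> a A B; rewrite opprD scalerN.
  exact: smooth_mulmx.
- exact: hproj_horizontal.
Qed.

(** The correction to the projected derivative in the connection, found by
    writing left-invariant parallel transport on O(n),
    z' = - [xi, z]_m / 2, in the ambient matrices. *)
Definition christoffel Y X Z : mat :=
  2^-1 *: ((1%:M - Y *m Y^T) *m (X *m (Y^T *m Z) + Z *m (Y^T *m X))).

Lemma christoffelC Y X Z : christoffel Y X Z = christoffel Y Z X.
Proof. by rewrite /christoffel [X in _ *m X]addrC. Qed.

Lemma tr_mul_christoffel Y X Z : stiefel Y -> Y^T *m christoffel Y X Z = 0.
Proof.
move=> YY; rewrite /christoffel -scalemxAr (mulmxA Y^T (_ - _)) mulmxBr mulmx1.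
by rewrite (mulmxA Y^T Y) YY mul1mx subrr mul0mx scaler0.
Qed.

Lemma christoffel_horizontal Y X Z :
  stiefel Y -> horizontal Y (christoffel Y X Z).
Proof.
by move=> YY; apply/horizontalP; rewrite tr_mul_christoffel // linear0.
Qed.

Fact christoffel_is_linear Y X : linear (christoffel Y X).
Proof.
move=> a M N; rewrite /christoffel.
have -> : X *m (Y^T *m (a *: M + N)) + (a *: M + N) *m (Y^T *m X) =
    a *: (X *m (Y^T *m M) + M *m (Y^T *m X)) +
    (X *m (Y^T *m N) + N *m (Y^T *m X)).
  by rewrite !mulmxDr mulmxDl -!scalemxAr -scalemxAl scalerDr addrACA.
by rewrite mulmxDr -scalemxAr scalerDr !scalerA mulrC.
Qed.

HB.instance Definition _ Y X :=
  GRing.isLinear.Build R mat mat _ (christoffel Y X)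
    (christoffel_is_linear Y X).

(** The right-hand side is, up to sign, the derivative of the metric itself
    along X, which comes from the factor Y Y^T.  Write x, z, w for the
    antisymmetric components of X, Z, W along Y.  On the left, the two traces
    with the factor x cancel by transposition; the other two differ from the
    right-hand side by a multiple of tr (z x w) + tr (w x z), which vanishes
    since z x w and - w x z are transposes of each other. *)
Lemma metric_christoffel Y X Z W :
  stiefel Y -> horizontal Y X -> horizontal Y Z -> horizontal Y W ->
  metric 2^-1 Y (christoffel Y X Z) W + metric 2^-1 Y Z (christoffel Y X W) =
  2^-1 * (\tr (Z^T *m X *m Y^T *m W) + \tr (Z^T *m Y *m X^T *m W)).
Proof.
move=> YY XH ZH WH.
pose P := 1%:M - Y *m Y^T.
have Pt : P^T = P by rewrite /P linearB /= trmx1 trmx_mul trmxK.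
pose T (a b c : mat) := \tr (Y^T *m a *m b^T *m P *m c).
have metricT a b c : horizontal Y a -> horizontal Y b ->
    metric 2^-1 Y (christoffel Y a b) c = - (2^-1 * (T b a c + T a b c)).
  move=> [a1 _] [b1 _]; rewrite /metric.
  have -> : (christoffel Y a b)^T *m Y = 0.
    by apply: trmx_inj; rewrite trmx_mul trmxK tr_mul_christoffel // trmx0.
  rewrite !mul0mx linear0 mulr0 addr0 /christoffel -/P.
  rewrite linearZ /= trmx_mul Pt [(_ + _)^T]linearD /=.
  rewrite (trmx_mul a) (trmx_mul b).
  rewrite a1 b1 !mulNmx -opprD mulNmx scalerN mulNmx linearN /=.
  by rewrite -scalemxAl linearZ /= !mulmxDl linearD.
have TA a b c : horizontal Y a -> T a b c = - T a c b.
  move=> aH; rewrite /T -[LHS]mxtrace_tr !trmx_mul Pt !trmxK.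
  rewrite (horizontal_tr aH) !mulmxN linearN /=.
  have -> : c^T *m (P *m (b *m (Y^T *m a))) = (c^T *m P *m b) *m (Y^T *m a).
    by rewrite !mulmxA.
  by rewrite mxtrace_mulC !mulmxA.
have TE a b c : horizontal Y b -> T a b c =
    \tr (Y^T *m a *m b^T *m c) + \tr (Y^T *m a *m (Y^T *m b) *m (Y^T *m c)).
  move=> bH; rewrite /T /P mulmxBr mulmx1 mulmxBl linearB /= -linearN /=.
  congr (_ + \tr _); rewrite (mulmxA _ Y) -(mulmxA _ b^T Y).
  by rewrite (horizontal_tr bH) mulmxN !mulNmx opprK -!mulmxA.
have XtrP a b : horizontal Y a -> horizontal Y b ->
    \tr (Y^T *m a *m (Y^T *m X) *m (Y^T *m b)) =
    - \tr (Y^T *m b *m (Y^T *m X) *m (Y^T *m a)).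
  move=> [a1 _] [b1 _]; rewrite -[LHS]mxtrace_tr.
  rewrite (trmx_mul (Y^T *m a *m _)) (trmx_mul (Y^T *m a)) a1 b1.
  have [-> _] := XH.
  by rewrite !(mulmxN, mulNmx, opprK) linearN /= !mulmxA.
have ZXW : \tr (Z^T *m X *m Y^T *m W) = - \tr (Y^T *m W *m X^T *m Z).
  have [w1 _] := WH.
  rewrite -[LHS]mxtrace_tr -mulmxA (trmx_mul (Z^T *m X)) (trmx_mul Z^T).
  rewrite w1 trmxK.
  by rewrite mulNmx linearN /= !mulmxA.
have ZYX : \tr (Z^T *m Y *m X^T *m W) = - \tr (Y^T *m Z *m X^T *m W).
  by rewrite (horizontal_tr ZH) !mulNmx linearN.
rewrite [metric _ _ Z _]metricC !metricT // (TA X W) // !TE // ZXW ZYX.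
by rewrite (XtrP W Z) //; lra.
Qed.

End HorizontalGeometry.

(** * Closed form of the Levi-Civita connection *)

Section LeviCivita.
Variables (R : realType) (n p : nat) (d_ : 'I_p -> nat).
Local Notation d := (\sum_i d_ i)%N.
Local Notation mat := 'M[R]_(n, d).
Implicit Types (Y M X Z W : mat).

Lemma horizontalB Y M N :
  horizontal Y M -> horizontal Y N -> horizontal Y (M - N).
Proof.
move=> /horizontalP ME /horizontalP NE; apply/horizontalP.
by rewrite mulmxBr linearB /= ME NE.
Qed.

(** The metric compatibility of the closed form of the connection.  It is stated
    for derivatives in a direction of any normed space, so as to apply both to
    fields on the ambient space and to fields along curves. *)
Lemma is_derive_metric (V : normedModType R) (x v : V) (Yf Zf Wf : V -> mat)
    dY dZ dW :
  is_derive x v Yf dY -> is_derive x v Zf dZ -> is_derive x v Wf dW ->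
  stiefel (Yf x) -> horizontal (Yf x) dY ->
  horizontal (Yf x) (Zf x) -> horizontal (Yf x) (Wf x) ->
  is_derive x v (fun y => metric 2^-1 (Yf y) (Zf y) (Wf y))
    (metric 2^-1 (Yf x) (hproj (Yf x) dZ - christoffel (Yf x) dY (Zf x)) (Wf x)
     + metric 2^-1 (Yf x) (Zf x)
         (hproj (Yf x) dW - christoffel (Yf x) dY (Wf x))).
Proof.
move=> dYf dZf dWf Yst dYH ZH WH.
rewrite metricBl metricBr metric_hproj // (metricC _ _ _ (hproj _ _)).
rewrite metric_hproj // (metricC _ _ dW).
have chrE := metric_christoffel Yst dYH ZH WH.
have dZt := is_derive_tr dZf.
have d1 := is_derive_mxtrace (is_derive_mulmx dZt dWf).
have d2 := is_derive_mxtrace (is_derive_mulmx (is_derive_mulmx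
  (is_derive_mulmx dZt dYf) (is_derive_tr dYf)) dWf).
apply: is_derive_eq (is_deriveD d1 (is_deriveZ (2^-1 - 1) d2)) _.
rewrite /GRing.scale /= !mulmxDl !linearD /=.
by move: chrE; rewrite /metric; do !move: (\tr _) => ?; lra.
Qed.

Variable nabla : (mat -> mat) -> (mat -> mat) -> (mat -> mat).
Hypothesis nabla_LC : levi_civita 2^-1 nabla.

(** The difference S of the two sides is tested at Y against global fields with
    a prescribed horizontal value there, in the end S itself. *)
Lemma levi_civitaE (X Z : mat -> mat) Y :
  flag_field X -> flag_field Z -> stiefel Y ->
  nabla X Z Y = hproj Y ('D_(X Y) Z Y) - christoffel Y (X Y) (Z Y).
Proof.
move=> XF ZF YY.
pose S (X Z : mat -> mat) : mat :=
  nabla X Z Y - (hproj Y ('D_(X Y) Z Y) - christoffel Y (X Y) (Z Y)).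
have fieldH F : flag_field F -> horizontal Y (F Y) by case=> _ + _; apply.
have fieldD F v : flag_field F -> is_derive Y v F ('D_v F Y).
  by case=> sF _ _; apply: is_derive_diff; exact: smooth_diff.
have nablaH F G : flag_field F -> flag_field G -> horizontal Y (nabla F G Y).
  by move=> FF GF; apply/fieldH; exact: (connection_field nabla_LC).
have S_sym F G : flag_field F -> flag_field G -> S F G = S G F.
  move=> FF GF.
  have /(hproj_vertical YY) := connection_torsion_free nabla_LC FF GF YY.
  rewrite /lie_bracket !linearB /=.
  rewrite (hproj_id (nablaH F G FF GF)) (hproj_id (nablaH G F GF FF)).
  move=> /eqP; rewrite -opprD subr_eq0 => /eqP nablaE.
  rewrite /S (christoffelC Y (G Y)).
  have exch (a b u w c : mat) : u - w = a - b -> a - (u - c) = b - (w - c).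
    move=> uw; rewrite -(subrK b a) -uw !opprB ![c - _]addrC !addrA.
    by congr (_ + c); rewrite -[_ - _ + b]addrA addrC addKr addrC.
  exact: exch.
have S_skew F G H : flag_field F -> flag_field G -> flag_field H ->
    metric 2^-1 Y (S F G) (H Y) = - metric 2^-1 Y (S F H) (G Y).
  move=> FF GF HF; have := connection_metric nabla_LC FF GF HF YY.
  have [_ ->] := is_derive_metric (is_derive_id Y (F Y)) (fieldD G (F Y) GF)
    (fieldD H (F Y) HF) YY (fieldH F FF) (fieldH G GF) (fieldH H HF).
  have exch (a b c e : R) : a + b = c + e -> c - a = - (e - b) by lra.
  move=> /exch kE; rewrite (metricC _ Y (S F H)) /S metricBl metricBr.
  exact: kE.
have SH : horizontal Y (S X Z).
  apply: horizontalB; first exact: nablaH.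
  apply: horizontalB; first exact: hproj_horizontal.
  exact: christoffel_horizontal.
apply/eqP; rewrite -subr_eq0; apply/eqP; rewrite -/(S X Z).
apply: (metric_eq0 YY).
pose W : mat -> mat := frame_field (S X Z *m Y^T).
have WF : flag_field W by exact: frame_flag_field.
have WY : W Y = S X Z by exact: frame_field_value.
(* A trilinear form symmetric in its first two arguments and antisymmetric in
   the last two vanishes. *)
have -> : metric 2^-1 Y (S X Z) (S X Z) = metric 2^-1 Y (S X Z) (W Y).
  by rewrite WY.
have E1 := S_skew _ _ _ XF ZF WF; rewrite (S_sym X W) // in E1.
have E2 := S_skew _ _ _ WF XF ZF; rewrite (S_sym W Z) // in E2.
have E3 := S_skew _ _ _ ZF WF XF; rewrite (S_sym Z X) // in E3.
have eq_opp0 (a : R) : a = - a -> a = 0 by lra.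
by apply: eq_opp0; rewrite {1}E1 E2 E3 opprK.
Qed.

End LeviCivita.

(** * Parallel fields along a horizontal curve *)

Section Parallel.
Variables (R : realType) (n p : nat) (d_ : 'I_p -> nat).
Local Notation d := (\sum_i d_ i)%N.
Local Notation mat := 'M[R]_(n, d).
Variable nabla : (mat -> mat) -> (mat -> mat) -> (mat -> mat).
Hypothesis nabla_LC : levi_civita 2^-1 nabla.
Variable gamma : R -> mat.
Hypothesis gammaH : horizontal_curve gamma.
Implicit Types (D : R -> mat) (t : R).

Let gamma_st t : stiefel (gamma t). Proof. by case: (gammaH t). Qed.

Lemma horizontal_curve_is_derive t :
  is_derive t (1 : R) gamma (derive1 gamma t).
Proof. by apply/is_derive1P; case: (gammaH t). Qed.

(** Differentiating D = sum_i f_i X_i(gamma) by the chain rule shows that its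
    covariant derivative depends on D alone, not on the f_i, X_i and V. *)
Lemma covariant_derivative_frame m (f : 'I_m -> R -> R) (X : 'I_m -> mat -> mat)
    (V : R -> mat -> mat) D t :
  (forall i, flag_field (X i) /\ (forall t, derivable (f i) t 1)) ->
  (forall t, flag_field (V t) /\ V t (gamma t) = derive1 gamma t) ->
  (forall t, D t = \sum_i f i t *: X i (gamma t)) ->
  [/\ derivable D t 1, horizontal (gamma t) (D t) &
    \sum_i (derive1 (f i) t *: X i (gamma t) +
            f i t *: nabla (V t) (X i) (gamma t)) =
    hproj (gamma t) (derive1 D t) -
      christoffel (gamma t) (derive1 gamma t) (D t)].
Proof.
move=> XF VF /funext ->; have [VFt Vg] := VF t.
have Xf i : flag_field (X i) by case: (XF i).
have dD : is_derive t (1 : R) (fun s => \sum_i f i s *: X i (gamma s))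
    (\sum_i (derive1 (f i) t *: X i (gamma t) +
             f i t *: 'D_(derive1 gamma t) (X i) (gamma t))).
  apply: is_derive_big => i; apply: is_derive_scalemx.
    by rewrite derive1E; apply: derivableP; case: (XF i).
  apply: is_derive_chain; first exact: horizontal_curve_is_derive.
  by apply: smooth_diff; case: (Xf i).
have XH i : hproj (gamma t) (X i (gamma t)) = X i (gamma t).
  by apply: hproj_id; case: (Xf i) => _ + _; apply.
have [dv D'] := (is_derive1P _ _ _).1 dD; split=> //.
  apply/horizontalP; rewrite mulmx_sumr !linear_sum; apply: eq_bigr => i _.
  rewrite -scalemxAr linearZ /=; congr (_ *: _); apply/horizontalP.
  by case: (Xf i) => _ + _; apply.
rewrite D' !linear_sum -big_split; apply: eq_bigr => i _ /=.
rewrite linearD /= [hproj _ (f i t *: _)]linearZ [hproj _ (_ *: _)]linearZ.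
rewrite [christoffel _ _ (_ *: _)]linearZ /= XH.
rewrite (levi_civitaE nabla_LC VFt (Xf i)) // Vg.
by rewrite scalerBr addrA.
Qed.

Lemma parallelP D :
  parallel nabla gamma D <->
  forall t, [/\ derivable D t 1, horizontal (gamma t) (D t) &
    hproj (gamma t) (derive1 D t) =
      christoffel (gamma t) (derive1 gamma t) (D t)].
Proof.
split=> [[m [f [X [V [XF VF DE D0]]]]] t | DP].
  have [dD DH DE'] := covariant_derivative_frame t XF VF DE.
  by split=> //; apply/eqP; rewrite -subr_eq0 -DE' -D0.
(* The n^2 fields associated with the elementary matrices span the horizontal
   spaces, and the coordinates of D are those of D gamma^T. *)
pose e (k : 'I_#|{: 'I_n * 'I_n}|) := enum_val k.
pose X k : mat -> mat := frame_field (delta_mx (e k).1 (e k).2).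
pose f k t := (D t *m (gamma t)^T) (e k).1 (e k).2.
pose V t : mat -> mat := frame_field (derive1 gamma t *m (gamma t)^T).
have XF i : flag_field (X i) /\ (forall t, derivable (f i) t 1).
  split=> [|t]; first exact: frame_flag_field.
  have dD : is_derive t (1 : R) D (derive1 D t).
    by apply/is_derive1P; case: (DP t).
  have := is_derive_mulmx dD (is_derive_tr (horizontal_curve_is_derive t)).
  by move=> /is_derive_mxP/(_ (e i).1 (e i).2) [].
have VF t : flag_field (V t) /\ V t (gamma t) = derive1 gamma t.
  split; first exact: frame_flag_field.
  by apply: frame_field_value => //; case: (gammaH t).
have DE t : D t = \sum_i f i t *: X i (gamma t).
  have [_ DH _] := DP t.
  rewrite -[LHS](frame_field_value (gamma_st t) DH) /frame_field.
  rewrite [D t *m _]matrix_sum_delta pair_big /= mulmx_suml linear_sum.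
  rewrite [RHS](reindex enum_rank) /=; last first.
    by exists enum_val => ? _; [exact: enum_rankK | exact: enum_valK].
  apply: eq_bigr => -[i j] _; rewrite -scalemxAl linearZ /=.
  by rewrite /f /X /frame_field /e enum_rankK.
exists _, f, X, V; split=> // t.
have [_ _ ->] := covariant_derivative_frame t XF VF DE.
by have [_ _ ->] := DP t; rewrite subrr.
Qed.

(** The difference of two parallel fields has constant norm. *)
Lemma parallel_unique D1 D2 :
  parallel nabla gamma D1 -> parallel nabla gamma D2 -> D1 0 = D2 0 ->
  forall t, D1 t = D2 t.
Proof.
move=> /parallelP P1 /parallelP P2 D0 t.
pose D s := D1 s - D2 s.
have dD s : is_derive s (1 : R) D (derive1 D1 s - derive1 D2 s).
  by apply: is_deriveB; apply/is_derive1P; [case: (P1 s) | case: (P2 s)].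
have DH s : horizontal (gamma s) (D s).
  by apply: horizontalB; [case: (P1 s) | case: (P2 s)].
have DP s : hproj (gamma s) (derive1 D1 s - derive1 D2 s) -
    christoffel (gamma s) (derive1 gamma s) (D s) = 0.
  have [[_ _ E1] [_ _ E2]] := (P1 s, P2 s).
  by rewrite /D [hproj _ _]linearB [christoffel _ _ _]linearB /= E1 E2 subrr.
apply/eqP; rewrite -subr_eq0; apply/eqP/(metric_eq0 (gamma_st t)).
have -> : 0 = metric 2^-1 (gamma 0) (D 0) (D 0).
  by rewrite /D D0 subrr metric0l.
apply: (is_derive_0_is_cst
  (f := fun s => metric 2^-1 (gamma s) (D s) (D s))) => s.
have [_ _ dgH] := gammaH s.
apply: is_derive_eq (is_derive_metric (horizontal_curve_is_derive s)
  (dD s) (dD s) (gamma_st s) dgH (DH s) (DH s)) _.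
by rewrite DP metric0l metric0r addr0.
Qed.

End Parallel.

(** * Geodesics and parallel transport in the moving frame *)

Section Geodesic.
Variables (R : realType) (n p : nat) (d_ : 'I_p -> nat).
Local Notation d := (\sum_i d_ i)%N.
Local Notation mat := 'M[R]_(n, d).

(** With a = g^T g', the component of the geodesic equation along g gives
    a' = 0, and the other one then expresses g'' in terms of g and g'; the
    derivative of Om vanishes when g'' is replaced. *)
Lemma geodesic_momentum
    (nabla : (mat -> mat) -> (mat -> mat) -> (mat -> mat)) (gamma : R -> mat) :
  levi_civita 2^-1 nabla -> horizontal_curve gamma ->
  parallel nabla gamma (derive1 gamma) ->
  let Om t := derive1 gamma t *m (gamma t)^T - gamma t *m (derive1 gamma t)^T -
              gamma t *m ((gamma t)^T *m derive1 gamma t) *m (gamma t)^T in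
  forall t, derive1 gamma t = Om 0 *m gamma t.
Proof.
move=> nabla_LC gammaH /(parallelP nabla_LC gammaH) geo Om t.
pose gamma1 := derive1 gamma; pose gamma2 := derive1 gamma1.
pose a s := (gamma s)^T *m gamma1 s.
have dg s : is_derive s (1 : R) gamma (gamma1 s).
  exact: horizontal_curve_is_derive.
have dg1 s : is_derive s (1 : R) gamma1 (gamma2 s).
  by apply/is_derive1P; case: (geo s).
have st s : stiefel (gamma s) by case: (gammaH s).
have g1H s : horizontal (gamma s) (gamma1 s) by case: (gammaH s).
have at_ s : (a s)^T = - a s by case: (g1H s).
have da s : is_derive s (1 : R) a
    ((gamma1 s)^T *m gamma1 s + (gamma s)^T *m gamma2 s).
  exact: is_derive_mulmx (is_derive_tr (dg s)) (dg1 s).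
(* The derivative of gamma^T gamma' is antisymmetric with zero diagonal
   blocks, while its image under the projection onto these matrices is the
   component of the geodesic equation along gamma. *)
have a'0 s : (gamma1 s)^T *m gamma1 s + (gamma s)^T *m gamma2 s = 0.
  have [_ _ geoE] := geo s.
  have [_ <-] := da s.
  have : is_derive s (1 : R) (fun r => flag_skew (a r)) (flag_skew ('D_1 a s)).
    apply: (is_derive_mxlin (@flag_skew_is_linear _ _ _)).
    by case: (da s) => dv _; exact: derivableP.
  have -> : (fun r => flag_skew (a r)) = a.
    by apply/funext=> r; apply/horizontalP.
  case=> _ {1}->; have [_ ->] := da s; rewrite linearD /=.
  rewrite flag_skew_sym ?trmx_mul ?trmxK // add0r -tr_mul_hproj // geoE.
  exact: tr_mul_christoffel.
have gg2 s : (gamma s)^T *m gamma2 s = - ((gamma1 s)^T *m gamma1 s).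
  by apply/eqP; rewrite -addr_eq0 addrC a'0.
pose m s := a s *m a s + (gamma1 s)^T *m gamma1 s.
have mt s : (m s)^T = m s.
  have sqt q r (X : 'M[R]_(q, r)) : (X^T *m X)^T = X^T *m X.
    by rewrite trmx_mul trmxK.
  rewrite /m [LHS]linearD /= sqt; congr (_ + _).
  by rewrite (trmx_mul (a s)) at_ mulNmx mulmxN opprK.
have g2E s : gamma2 s = gamma1 s *m a s - gamma s *m m s.
  have [_ _] := geo s; rewrite /hproj gg2 [flag_skew _]linearN /= flag_skew_sym.
  - rewrite oppr0 mulmx0 addr0 mulmxN opprK => geoE.
    rewrite -[LHS](addrK (gamma s *m ((gamma1 s)^T *m gamma1 s))) geoE.
    rewrite /christoffel mulmxDr scalerDr -scalerDl -[2^-1]mul1r -splitr.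
    rewrite scale1r mulmxBl mul1mx -/(a s) -/gamma1 /m mulmxDr opprD addrA.
    by rewrite -!mulmxA.
  - by rewrite trmx_mul trmxK.
have dOm s : is_derive s (1 : R) Om 0.
  have d1 := is_derive_mulmx (dg1 s) (is_derive_tr (dg s)).
  have d2 := is_derive_mulmx (dg s) (is_derive_tr (dg1 s)).
  have d3 := is_derive_mulmx (is_derive_mulmx (dg s) (da s))
    (is_derive_tr (dg s)).
  apply: is_derive_eq (is_deriveB (is_deriveB d1 d2) d3) _.
  have cancel (x y z u : 'M[R]_n) : x - z = u -> x + y - (y + z) - u = 0.
    by move=> <-; rewrite opprD addrA addrK subrr.
  apply: cancel; rewrite a'0 mulmx0 addr0 -/(a s).
  have -> : (gamma2 s)^T = - (a s *m (gamma1 s)^T) - m s *m (gamma s)^T.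
    rewrite g2E [LHS]linearB /= (trmx_mul _ (a s)) (trmx_mul _ (m s)).
    by rewrite mt at_ mulNmx.
  rewrite g2E mulmxBl mulmxBr mulmxN opprB !mulmxA opprK addrA.
  by rewrite subrK.
have OmE s : Om s *m gamma s = gamma1 s.
  rewrite /Om -/gamma1 -/(a s) !mulmxBl -!mulmxA st !mulmx1.
  by rewrite (horizontal_tr (g1H s)) mulmxN opprK addrK.
by rewrite -/(gamma1 t) -OmE (mx_curve_cst dOm).
Qed.

(** An antisymmetric generator preserves c^T c for every solution c, here for
    the difference of c1 and c2. *)
Lemma skew_flow_unique q (Om : 'M[R]_n) (c1 c2 : R -> 'M[R]_(n, q)) :
  Om^T = - Om ->
  (forall t, is_derive t (1 : R) c1 (Om *m c1 t)) ->
  (forall t, is_derive t (1 : R) c2 (Om *m c2 t)) ->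
  c1 0 = c2 0 -> forall t, c1 t = c2 t.
Proof.
move=> Omt d1 d2 c0 t; pose c s := c1 s - c2 s.
have dc s : is_derive s (1 : R) c (Om *m c s).
  by rewrite /c mulmxBr; exact: is_deriveB.
have dcc s : is_derive s (1 : R) (fun r => (c r)^T *m c r) 0.
  apply: is_derive_eq (is_derive_mulmx (is_derive_tr (dc s)) (dc s)) _.
  by rewrite trmx_mul Omt mulmxN mulNmx mulmxA addNr.
have cc0 : (c t)^T *m c t = 0.
  by rewrite (mx_curve_cst dcc) /c c0 subrr mulmx0.
apply/eqP; rewrite -subr_eq0; apply/eqP/mxtrace_sq_eq0.
by rewrite cc0 linear0.
Qed.

Section Frame.
Variables (k : nat) (A : 'M[R]_d) (B : 'M[R]_(k, d)).

Lemma transport_op_linear : linear (transport_op A B).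
Proof.
move=> a M N; rewrite /transport_op -!/(flag_skew _) scale_col_mx add_col_mx.
have uE : usubmx (a *: M + N) = a *: usubmx M + usubmx N.
  by apply/matrixP=> i j; rewrite !mxE.
have vE : dsubmx (a *: M + N) = a *: dsubmx M + dsubmx N.
  by apply/matrixP=> i j; rewrite !mxE.
rewrite uE vE; congr col_mx.
  rewrite -[RHS]linearP; congr flag_skew.
  by rewrite mulmxDl mulmxDr -scalemxAl -scalemxAr addrACA -scalerDr.
rewrite scalerA mulrC -scalerA -scalerDr mulmxDl mulmxDr -scalemxAl -scalemxAr.
by rewrite opprD addrACA -scalerBr.
Qed.

Hypothesis AE : flag_skew A = A.
Let V : 'M[R]_(d + k) := block_mx A (- B^T) B 0.

(** The equation of parallel fields at one value of t, with g the foot point,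
    g1 the velocity, D the transported vector and D1 its derivative.  The
    component of D1 along g is A wa - B^T wr plus the first block of
    transport_op, and is killed by the projection because A wa + wa A is
    symmetric.  On the orthogonal complement of g, both sides are equal to
    G [0; B wa + wr A] / 2 + E e A / 2. *)
Lemma transport_equation (G : 'M[R]_(n, d + k)) (E : mat) (e : 'M[R]_d)
    (w : 'M[R]_(d + k, d)) :
  G^T *m G = 1%:M -> G^T *m E = 0 -> flag_skew (usubmx w) = usubmx w ->
  let g := G *m col_mx 1%:M 0 in
  let g1 := G *m (V *m col_mx 1%:M 0) in
  let D := G *m w + E *m e in
  let D1 := G *m (V *m w + transport_op A B w) + E *m (e *m (2^-1 *: A)) in
  [/\ stiefel g, horizontal g g1, horizontal g D &
      hproj g D1 = christoffel g g1 D].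
Proof.
move=> GG GE; rewrite -{3 4}(vsubmxK w).
set wa := usubmx w; set wr := dsubmx w => waE g g1 D D1.
have At : A^T = - A by rewrite -AE flag_skew_tr.
have wat : wa^T = - wa by rewrite -waE flag_skew_tr.
have gtG m (u : 'M[R]_(d, m)) (v : 'M[R]_(k, m)) : g^T *m (G *m col_mx u v) = u.
  rewrite /g trmx_mul tr_col_mx trmx1 trmx0 -mulmxA (mulmxA G^T) GG mul1mx.
  by rewrite mul_row_col mul1mx mul0mx addr0.
have gtE : g^T *m E = 0 by rewrite /g trmx_mul -mulmxA GE mulmx0.
have VE m (u : 'M[R]_(d, m)) (v : 'M[R]_(k, m)) :
    V *m col_mx u v = col_mx (A *m u - B^T *m v) (B *m u).
  by rewrite /V mul_block_col mul0mx addr0 mulNmx.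
have g1E : g1 = G *m col_mx A B.
  by rewrite /g1 VE !mulmx1 mulmx0 subr0.
have gtg1 : g^T *m g1 = A by rewrite g1E gtG.
have gtD : g^T *m D = wa by rewrite /D mulmxDr gtG mulmxA gtE mul0mx addr0.
have st : stiefel g by rewrite /stiefel {2}/g gtG.
split=> //; try by apply/horizontalP; rewrite ?gtg1 ?gtD.
set S := g1 *m wa + D *m A.
have SE : S = G *m col_mx (A *m wa + wa *m A) (B *m wa + wr *m A) +
    E *m (e *m A).
  rewrite /S /D g1E mulmxDl -!mulmxA !mul_col_mx addrA -mulmxDr.
  by rewrite add_col_mx.
have gtS : g^T *m S = A *m wa + wa *m A.
  by rewrite SE mulmxDr gtG mulmxA gtE mul0mx addr0.
have -> : christoffel g g1 D = 2^-1 *: (G *m col_mx 0 (B *m wa + wr *m A) +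
    E *m (e *m A)).
  rewrite /christoffel gtg1 gtD -/S mulmxBl mul1mx -mulmxA gtS SE /g.
  rewrite -[G *m col_mx 1%:M 0 *m _]mulmxA mul_col_mx mul1mx mul0mx addrAC.
  by rewrite -mulmxBr opp_col_mx add_col_mx subrr oppr0 addr0.
pose K := wa *m A + B^T *m wr.
have D1E : D1 = G *m col_mx (A *m wa - B^T *m wr + flag_skew K)
    (2^-1 *: (B *m wa + wr *m A)) + 2^-1 *: (E *m (e *m A)).
  rewrite /D1 VE /transport_op -/wa -/wr -/K -/(flag_skew K) add_col_mx.
  rewrite -!scalemxAr; congr (G *m col_mx _ _ + _).
  have halves (x y : 'M[R]_(k, d)) : x + 2^-1 *: (y - x) = 2^-1 *: (x + y).
    rewrite -[X in X + _]scale1r [X in X *: _](splitr 1) mul1r.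
    by rewrite scalerDl -!scalerDr -addrA [x + (y - x)]addrC subrK.
  exact: halves.
have gtD1 : g^T *m D1 = A *m wa - B^T *m wr + flag_skew K.
  by rewrite D1E mulmxDr gtG -scalemxAr (mulmxA g^T E) gtE mul0mx scaler0 addr0.
have skew0 : flag_skew (g^T *m D1) = 0.
  rewrite gtD1 [flag_skew (_ + flag_skew K)]linearD /=.
  rewrite [flag_skew (_ - _)]linearB /= flag_skewK /K.
  rewrite [flag_skew (wa *m A + _)]linearD /= [X in _ + X]addrC addrA subrK.
  rewrite -linearD /= flag_skew_sym // [LHS]linearD /= !trmx_mul At wat.
  by rewrite !mulNmx !mulmxN !opprK addrC.
rewrite /hproj skew0 mulmx0 addr0 gtD1 D1E /g -[G *m _ *m _]mulmxA mul_col_mx.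
rewrite mul1mx mul0mx addrAC -mulmxBr opp_col_mx add_col_mx subrr oppr0 addr0.
rewrite [RHS]scalerDr; congr (_ + _).
by rewrite [RHS]scalemxAr scale_col_mx scaler0.
Qed.

End Frame.

Lemma row_mx_orthonormal q r (Y : 'M[R]_(n, q)) (Q : 'M[R]_(n, r)) :
  Y^T *m Y = 1%:M -> Q^T *m Q = 1%:M -> Y^T *m Q = 0 ->
  (row_mx Y Q)^T *m row_mx Y Q = 1%:M.
Proof.
move=> YY QQ YQ.
have QY : Q^T *m Y = 0 by apply: trmx_inj; rewrite trmx_mul trmxK YQ trmx0.
by rewrite tr_row_mx mul_col_row YY YQ QY QQ -scalar_mx_block.
Qed.

Section Transport.
Variables (nabla : (mat -> mat) -> (mat -> mat) -> (mat -> mat)).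
Hypothesis nabla_LC : levi_civita 2^-1 nabla.
Variables (k : nat) (Y xi : mat) (A : 'M[R]_d) (Q : 'M[R]_(n, k)).
Variable B : 'M[R]_(k, d).
Hypotheses (Y_St : stiefel Y) (xi_hor : horizontal Y xi).
Hypothesis A_def : A = Y^T *m xi.
Hypothesis Q_orthonormal : Q^T *m Q = 1%:M.
Hypothesis YQ : Y^T *m Q = 0.
Hypothesis xi_dec : xi = Y *m A + Q *m B.

Let V : 'M[R]_(d + k) := block_mx A (- B^T) B 0.
Let G t := row_mx Y Q *m expm (t *: V).

Definition explicit_geodesic t : mat := G t *m col_mx 1%:M 0.

Let AE : flag_skew A = A.
Proof. by rewrite A_def; apply/horizontalP. Qed.

Let Vt : V^T = - V.
Proof.
rewrite /V tr_block_mx opp_block_mx trmx0 oppr0 linearN /= trmxK opprK.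
by rewrite -AE flag_skew_tr.
Qed.

Let G_orthonormal t : (G t)^T *m G t = 1%:M.
Proof.
rewrite /G trmx_mul -mulmxA (mulmxA _ (row_mx Y Q)).
rewrite (row_mx_orthonormal Y_St) // mul1mx.
exact: expm_orthogonal.
Qed.

Let is_derive_G t : is_derive t (1 : R) G (G t *m V).
Proof.
rewrite /G -mulmxA; apply: is_derivexM; exact: is_derive_expmr.
Qed.

Let is_derive_geodesic t :
  is_derive t (1 : R) explicit_geodesic (G t *m (V *m col_mx 1%:M 0)).
Proof. by rewrite mulmxA; apply: is_deriveMx; exact: is_derive_G. Qed.

Lemma explicit_geodesic_horizontal : horizontal_curve explicit_geodesic.
Proof.
move=> t; have dg := is_derive_geodesic t.
have w0 : let w : 'M[R]_(d + k, d) := 0 in flag_skew (usubmx w) = usubmx w.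
  rewrite /= (_ : usubmx _ = 0); last by apply/matrixP=> i j; rewrite !mxE.
  by rewrite linear0.
have [st gH _ _] := transport_equation B AE (E := 0) 0 (G_orthonormal t)
  (mulmx0 _ _) w0.
by have [dv gE] := (is_derive1P _ _ _).1 dg; split; rewrite ?gE.
Qed.

Lemma transport_parallel (w : R -> 'M[R]_(d + k, d)) (e : R -> 'M[R]_d) E :
  (forall t, is_derive t (1 : R) w (transport_op A B (w t))) ->
  (forall t, is_derive t (1 : R) e (e t *m (2^-1 *: A))) ->
  (row_mx Y Q)^T *m E = 0 -> flag_skew (usubmx (w 0)) = usubmx (w 0) ->
  parallel nabla explicit_geodesic (fun t => G t *m w t + E *m e t).
Proof.
move=> dw de E0 w0.
apply/(parallelP nabla_LC explicit_geodesic_horizontal) => t.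
(* The flow of transport_op stays among the coordinates of horizontal vectors,
   as the upper block of its values is in the range of the projection. *)
have wt : flag_skew (usubmx (w t)) = usubmx (w t).
  pose h s := usubmx (w s) - flag_skew (usubmx (w s)).
  have usubL : linear (@usubmx R d k d).
    by move=> a M N; apply/matrixP=> i j; rewrite !mxE.
  have dh s : is_derive s (1 : R) h 0.
    have du := is_derive_mxlin usubL (dw s).
    apply: is_derive_eq (is_deriveB du
      (is_derive_mxlin (@flag_skew_is_linear _ _ _) du)) _.
    by rewrite /transport_op col_mxKu flag_skewK subrr.
  by apply/esym/eqP; rewrite -subr_eq0 -/(h t) (mx_curve_cst dh) /h w0 subrr.
have GE : (G t)^T *m E = 0 by rewrite /G trmx_mul -mulmxA E0 mulmx0.
have [st gH DH DP] := transport_equation B AE (e t) (G_orthonormal t) GE wt.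
have dD : is_derive t (1 : R) (fun t => G t *m w t + E *m e t)
    (G t *m (V *m w t + transport_op A B (w t)) + E *m (e t *m (2^-1 *: A))).
  apply: is_derive_eq (is_deriveD (is_derive_mulmx (is_derive_G t) (dw t))
    (is_derivexM E (de t))) _.
  by rewrite (mulmxDr (G t)) (mulmxA (G t) V).
have [dv D'] := (is_derive1P _ _ _).1 dD.
have [_ g'] := (is_derive1P _ _ _).1 (is_derive_geodesic t).
by split=> //; rewrite D' g'.
Qed.

Lemma explicit_geodesic0 : explicit_geodesic 0 = Y.
Proof.
by rewrite /explicit_geodesic /G expm0 mulmx1 mul_row_col mulmx1 mulmx0 addr0.
Qed.

Let V1 : V *m col_mx 1%:M 0 = col_mx A B.
Proof. by rewrite /V mul_block_col !mulmx1 !mulmx0 !addr0. Qed.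

Lemma explicit_geodesic_lift : geodesic_lift nabla Y xi explicit_geodesic.
Proof.
have dg t := ((is_derive1P _ _ _).1 (is_derive_geodesic t)).2.
split; [exact: explicit_geodesic_horizontal | | exact: explicit_geodesic0 |].
  (* The velocity is the transport of xi, for which w is constant and E = 0. *)
  have := @transport_parallel (fun=> col_mx A B)
    (fun t => expm (t *: (2^-1 *: A))) 0.
  have -> : (fun t => G t *m col_mx A B + 0 *m expm (t *: (2^-1 *: A))) =
      derive1 explicit_geodesic.
    by apply/funext=> t; rewrite mul0mx addr0 dg V1.
  apply=> [t|t||]; [|exact: is_derive_expmr|exact: mulmx0|by rewrite col_mxKu].
  apply: is_derive_eq (is_derive_cst _ _ _) _.
  rewrite /transport_op col_mxKu col_mxKd subrr scaler0 -/(flag_skew _).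
  rewrite flag_skew_sym ?col_mx0 // linearD /= !trmx_mul trmxK.
  by rewrite -AE flag_skew_tr mulNmx mulmxN opprK.
rewrite dg V1 /G expm0 mulmx1 mul_row_col.
by rewrite -xi_dec.
Qed.

Lemma geodesic_lift_unique gamma :
  geodesic_lift nabla Y xi gamma -> gamma = explicit_geodesic.
Proof.
case=> gH /(geodesic_momentum nabla_LC gH) /= + g0 dg0.
have [cH /(geodesic_momentum nabla_LC cH) /= + c0 dc0] :=
  explicit_geodesic_lift.
rewrite g0 dg0 c0 dc0; set Om := xi *m Y^T - _ - _ => cOm gOm.
apply/funext; apply: (@skew_flow_unique _ Om) => [|t|t|]; last by rewrite g0 c0.
- have [xiY _] := xi_hor.
  rewrite /Om [LHS]linearB /= [(_ - _)^T]linearB /=.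
  rewrite (trmx_mul xi) (trmx_mul Y xi^T).
  rewrite (trmx_mul (Y *m (Y^T *m xi))) (trmx_mul Y (Y^T *m xi)) xiY !trmxK.
  by rewrite mulNmx mulmxN (mulmxA Y) opprK [RHS]opprB opprB addrC.
- by rewrite -gOm; exact: horizontal_curve_is_derive.
- by rewrite -cOm; exact: horizontal_curve_is_derive.
Qed.

End Transport.

End Geodesic.

Theorem proposition6 (R : realType) (n p k : nat) (d_ : 'I_p -> nat)
  (p_gt0 : (0 < p)%N) (d_gt0 : forall i, (0 < d_ i)%N)
  (d_lt_n : (\sum_i d_ i < n)%N)
  (nabla : ('M[R]_(n, \sum_i d_ i) -> 'M[R]_(n, \sum_i d_ i)) ->
           ('M[R]_(n, \sum_i d_ i) -> 'M[R]_(n, \sum_i d_ i)) ->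
           ('M[R]_(n, \sum_i d_ i) -> 'M[R]_(n, \sum_i d_ i)))
  (nabla_LC : levi_civita (2^-1) nabla)
  (Y xi : 'M[R]_(n, \sum_i d_ i))
  (A : 'M[R]_(\sum_i d_ i)) (Q : 'M[R]_(n, k)) (B : 'M[R]_(k, \sum_i d_ i))
  (Y_St : stiefel Y) (xi_hor : horizontal Y xi)
  (A_def : A = Y^T *m xi)
  (Q_orthonormal : Q^T *m Q = 1%:M)
  (Q_span : (Q^T == (xi - Y *m Y^T *m xi)^T)%MS)
  (xi_dec : xi = Y *m A + Q *m B)
  (eta : 'M[R]_(n, \sum_i d_ i)) (eta_hor : horizontal Y eta) :
  (exists gamma : R -> 'M[R]_(n, \sum_i d_ i), geodesic_lift nabla Y xi gamma) /\
  (forall gamma : R -> 'M[R]_(n, \sum_i d_ i), geodesic_lift nabla Y xi gamma ->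
   forall Delta : R -> 'M[R]_(n, \sum_i d_ i),
     parallel_transport_lift nabla gamma eta Delta <->
     (forall t : R,
        Delta t =
          row_mx Y Q *m expm (t *: block_mx A (- B^T) B 0)
            *m expv (fun W => t *: transport_op A B W) ((row_mx Y Q)^T *m eta)
          + (eta - Y *m Y^T *m eta - Q *m Q^T *m eta) *m expm ((t / 2) *: A))).
Proof.
have YQ : Y^T *m Q = 0.
  have /andP[/submxP[M QM] _] := Q_span.
  have -> : Q = (xi - Y *m Y^T *m xi) *m M^T.
    by rewrite -[Q]trmxK QM trmx_mul trmxK.
  by rewrite mulmxA mulmxBr !mulmxA Y_St mul1mx subrr mul0mx.
pose geo := explicit_geodesic Y A Q B.
have geoL : geodesic_lift nabla Y xi geo by exact: explicit_geodesic_lift.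
split=> [|gamma gammaL Delta]; first by exists geo.
have {gamma gammaL} -> : gamma = geo by exact: geodesic_lift_unique gammaL.
set E := eta - _ - _.
pose transport t := row_mx Y Q *m expm (t *: block_mx A (- B^T) B 0)
  *m expv (fun W => t *: transport_op A B W) ((row_mx Y Q)^T *m eta)
  + E *m expm (t *: (2^-1 *: A)).
have transportE t : E *m expm ((t / 2) *: A) = E *m expm (t *: (2^-1 *: A)).
  by rewrite scalerA.
have frame_proj : row_mx Y Q *m ((row_mx Y Q)^T *m eta) =
    Y *m Y^T *m eta + Q *m Q^T *m eta.
  by rewrite tr_row_mx mulmxA mul_row_col mulmxDl.
have EE : E = eta - row_mx Y Q *m ((row_mx Y Q)^T *m eta).
  by rewrite frame_proj /E opprD addrA.
have E0 : (row_mx Y Q)^T *m E = 0.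
  rewrite EE mulmxBr (mulmxA _ (row_mx Y Q)) (row_mx_orthonormal Y_St) //.
  by rewrite mul1mx subrr.
have transport_par : parallel nabla geo transport.
  apply: (transport_parallel nabla_LC Y_St xi_hor A_def Q_orthonormal YQ) => //.
  - by move=> t; exact: is_derive_expv (transport_op_linear A B) t _.
  - by move=> t; exact: is_derive_expmr.
  - rewrite expv0 tr_row_mx mul_col_mx col_mxKu; exact/horizontalP.
have transport0 : transport 0 = eta.
  by rewrite /transport !expm0 expv0 !mulmx1 EE addrC subrK.
split=> [[par D0] t | DE].
  rewrite transportE; apply: (parallel_unique nabla_LC _ par transport_par).
    by case: geoL.
  by rewrite D0 transport0.
have -> : Delta = transport by apply/funext=> t; rewrite DE transportE.
by split.
Qed.
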